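(* Let $T=\{2143,2341,3412\}$. Then $$F_T(x)=\frac{1-6x+13x^2-11x^3+5x^4}{(1-x)^2(1-2x)(1-3x+x^2)}.$$
   Context: $S_n(T)$ denotes the set of permutations $\pi$ of $[n]=\{1,\dots,n\}$ (one-line notation) that avoid every pattern $\tau\in T$, i.e. no subsequence of $\pi$ is order-isomorphic to $\tau$. $F_T(x)=\sum_{n\ge 0}|S_n(T)|x^n$, a formal power series, with $|S_0(T)|=1$. *)

(* Defs.v *)
From mathcomp Require Import all_boot all_order all_algebra all_fingroup.

Set Implicit Arguments.
Unset Strict Implicit.
Unset Printing Implicit Defensive.

Import GRing.Theory.

(** * Pattern avoidance *)

Section Patterns.

Local Open Scope nat_scope.

(* 'S_n permutes {0, ..., n-1}; the shift makes this a word on {1, ..., n}. *)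
Definition one_line n (p : 'S_n) : seq nat := [seq (p i).+1 | i <- enum 'I_n].

Definition order_iso (s t : seq nat) : bool :=
  (size s == size t) &&
  [forall i : 'I_(size s), forall j : 'I_(size s),
     (nth 0 s i < nth 0 s j) == (nth 0 t i < nth 0 t j)].

(* The subsequences of [w] are the words [mask m w], [m] a bit mask. *)
Definition has_pattern (t w : seq nat) : bool :=
  [exists m : (size w).-tuple bool, order_iso (mask m w) t].

Lemma has_patternP (t w : seq nat) :
  reflect (exists2 s, subseq s w & order_iso s t) (has_pattern t w).
Proof.
apply: (iffP existsP) => [[m mP]|[s /subseqP[m sz_m ->] mP]].
  by exists (mask m w) => //; apply: mask_subseq.
by exists (Tuple (introT eqP sz_m)).
Qed.

Definition avoiders (T : seq (seq nat)) n : {set 'S_n} :=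
  [set p : 'S_n | all (fun t => ~~ has_pattern t (one_line p)) T].

End Patterns.

(** * Formal power series, given by their coefficient sequences *)

Section PowerSeries.

Local Open Scope ring_scope.

Definition fps (R : Type) := nat -> R.

Variable R : comUnitRingType.
Implicit Types a b : fps R.

Definition fps_of_poly (p : {poly R}) : fps R := fun n => p`_n.

Definition fps_mul a b : fps R := fun n => \sum_(i < n.+1) a i * b (n - i)%N.

(* The first [n.+1] coefficients of the inverse of [a], from the recurrence
   b_0 = 1 / a_0  and  b_(n+1) = - (\sum_(i <= n) a_(n+1-i) b_i) / a_0. *)
Fixpoint fps_inv_seq a n : seq R :=
  if n is n'.+1 then
    let s := fps_inv_seq a n' in
    rcons s (- (a 0%N)^-1 * \sum_(i < n) a (n - i)%N * s`_i)
  else [:: (a 0%N)^-1].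

(* Meaningful only when [a 0] is a unit. *)
Definition fps_inv a : fps R := fun n => (fps_inv_seq a n)`_n.

Definition fps_div a b : fps R := fps_mul a (fps_inv b).

Lemma size_fps_inv_seq a n : size (fps_inv_seq a n) = n.+1.
Proof. by elim: n => //= n IHn; rewrite size_rcons IHn. Qed.

Lemma nth_fps_inv_seq a n i : (i <= n)%N -> (fps_inv_seq a n)`_i = fps_inv a i.
Proof.
elim: n => [|n IHn]; first by rewrite leqn0 => /eqP->.
rewrite leq_eqVlt => /predU1P[-> //|lt_in].
by rewrite /= nth_rcons size_fps_inv_seq lt_in IHn.
Qed.

Lemma fps_mulrV a :
  a 0%N \is a GRing.unit -> fps_mul a (fps_inv a) =1 fps_of_poly 1.
Proof.
move=> Ua n; rewrite /fps_mul /fps_of_poly coef1.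
case: n => [|n]; first by rewrite big_ord1 /fps_inv /= divrr.
rewrite big_ord_recl subn0.
have -> : fps_inv a n.+1 =
    - (a 0%N)^-1 * \sum_(i < n.+1) a (n.+1 - i)%N * (fps_inv_seq a n)`_i.
  by rewrite {1}/fps_inv /= nth_rcons size_fps_inv_seq ltnn eqxx.
rewrite mulrA mulrN divrr // mulN1r addrC; apply/eqP; rewrite subr_eq0; apply/eqP.
rewrite (reindex_inj rev_ord_inj); apply: eq_bigr => i _.
have le_in : (i <= n)%N by rewrite -ltnS.
have -> : (lift ord0 (rev_ord i) : nat) = (n.+1 - i)%N.
  by rewrite /= /bump /= add1n subSS subSn.
by rewrite nth_fps_inv_seq // subKn // leqW.
Qed.

End PowerSeries.

Definition avoiders_gf (T : seq (seq nat)) : fps int :=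
  fun n => Posz #|avoiders T n|.

(* Main.v *)
(** Sort the avoiders by their first letter [k].  When [k] is the least or the
    greatest letter, the rest is an arbitrary avoider.  Otherwise let [u] be the
    letter next above [k], let [L] be the set of the letters below [k] and [U]
    that of the letters above [u].  The patterns 2143 and 2341 with [k] as 2
    forbid a letter of [U] between two letters of [L + u], so that the word is
    [k A c B] with [c] on [L + u], [A] decreasing, [B] increasing, and [A], [B]
    sharing out [U].  If [A] is empty, [c] is any avoider which is decreasing
    after its maximum [u]; if not, 3412 makes the letters of [L] decrease and
    then [A] and the place of [u] in [c] are arbitrary.  If [a n] counts the
    avoiders and [b n] those [c] on [n + 1] letters that do not end with [u],
    this gives [b 1 = 1], [b (p + 2) = 2 b (p + 1) + p + 1] and
    [a (n + 2) = 2 a (n + 1) + \sum_(1 <= p <= n)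
                  (a p + b p + (p + 1) (2 ^ (n - p) - 1))],
    hence [a (n + 2) = 3 a (n + 1) - a n + 3 * 2 ^ n - 2 n - 3]. *)
Require Import Defs.
From mathcomp Require Import all_boot all_order all_algebra all_fingroup.
From mathcomp Require Import zify ring.

Set Implicit Arguments.
Unset Strict Implicit.
Unset Printing Implicit Defensive.

Import GRing.Theory.

(** * Words and forbidden patterns *)

(** The list of cut points computes when [s] is an explicit word, so that a four-letter subsequence
    of a concatenation unfolds into a finite disjunction over the blocks. *)
Lemma subseq_catE (T : eqType) (s t1 t2 : seq T) :
  subseq s (t1 ++ t2) =
  has (fun i => subseq (take i s) t1 && subseq (drop i s) t2)
      (iota 0 (size s).+1).
Proof.
apply/idP/hasP => [|[i _ /andP[h1 h2]]]; last first.
  by rewrite -(cat_take_drop i s) cat_subseq.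
case/subseqP=> b; rewrite size_cat => szb ->.
have szb1 : size (take (size t1) b) = size t1 by rewrite size_takel // szb leq_addr.
rewrite -{1 2 3}(cat_take_drop (size t1) b) mask_cat //.
set s1 := mask _ t1; set s2 := mask _ t2.
exists (size s1); first by rewrite mem_iota size_cat /= add0n ltnS leq_addr.
by rewrite take_size_cat // drop_size_cat // !mask_subseq.
Qed.

Lemma sorted_subseq2 (T : eqType) (r : rel T) (s : seq T) :
  (forall x y, subseq [:: x; y] s -> r x y) -> sorted r s.
Proof.
case: s => // x s; elim: s x => // y s IHs x h.
apply/andP; split; first by apply: h; rewrite /= !eqxx sub0seq.
by apply: IHs => a b hab; apply: h; apply: subseq_trans hab (subseq_cons _ _).
Qed.

Lemma split_first (T : Type) (p : pred T) (s : seq T) :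
  has p s -> exists s1 x s2, [/\ s = s1 ++ x :: s2, p x & all (predC p) s1].
Proof.
elim: s => //= x s IHs; case: (boolP (p x)) => [px _|npx /= /IHs[s1 [y [s2 [-> py h]]]]].
  by exists [::], x, s.
by exists (x :: s1), y, s2; rewrite /= npx.
Qed.

Lemma split_last (T : Type) (p : pred T) (s : seq T) :
  has p s -> exists s1 x s2, [/\ s = s1 ++ x :: s2, p x & all (predC p) s2].
Proof.
rewrite -(has_rev p) => /split_first[s1 [x [s2 [e px h]]]].
exists (rev s2), x, (rev s1); split; rewrite ?all_rev //.
by rewrite -(revK s) e rev_cat rev_cons cat_rcons.
Qed.

Lemma uniq_flatten_key (I T : eqType) (F : I -> seq T) (key : T -> I) (s : seq I) :
  uniq s -> {in s, forall i, uniq (F i)} ->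
  {in s, forall i, {in F i, forall x, key x = i}} ->
  uniq (flatten [seq F i | i <- s]).
Proof.
elim: s => //= i s IHs /andP[nis us] uF kF.
rewrite cat_uniq uF ?mem_head // IHs // => [|j js|j js]; last 2 first.
- by apply: uF; rewrite inE js orbT.
- by apply: kF; rewrite inE js orbT.
rewrite andbT; apply/hasPn => x /flatten_mapP[j js xj]; apply/negP => xi.
have ki := kF i (mem_head _ _) x xi.
have kj : key x = j by apply: kF xj; rewrite inE js orbT.
by rewrite -ki kj js in nis.
Qed.

Definition forbidden : seq (seq nat) :=
  [:: [:: 2; 1; 4; 3]; [:: 2; 3; 4; 1]; [:: 3; 4; 1; 2]].

Definition av (w : seq nat) := all (fun t => ~~ has_pattern t w) forbidden.

(** The disjuncts are 2143, 2341 and 3412, each written as a chain of inequalities. *)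
Definition bad a b c d :=
  [|| (b < a < d) && (d < c), (d < a < b) && (b < c) | (c < d < a) && (a < b)].

Lemma order_iso4 a b c d x y z t :
  order_iso [:: a; b; c; d] [:: x; y; z; t] =
  [&& (a < b) == (x < y), (a < c) == (x < z), (a < d) == (x < t),
      (b < c) == (y < z), (b < d) == (y < t), (c < d) == (z < t),
      (b < a) == (y < x), (c < a) == (z < x), (d < a) == (t < x),
      (c < b) == (z < y), (d < b) == (t < y) & (d < c) == (t < z)].
Proof.
rewrite /order_iso eqxx /=; apply/forallP/idP => [h|].
  pose o i := nth ord0 [:: @Ordinal 4 0 isT; @Ordinal 4 1 isT;
    @Ordinal 4 2 isT; @Ordinal 4 3 isT] i.
  have g i j := forallP (h (o i)) (o j).
  by rewrite !(g 0 1, g 0 2, g 0 3, g 1 2, g 1 3, g 2 3,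
             g 1 0, g 2 0, g 3 0, g 2 1, g 3 1, g 3 2).
case/and5P=> h1 h2 h3 h4 /and5P[h5 h6 h7 h8 /and4P[h9 h10 h11 h12]].
case=> [[|[|[|[|i]]]] //= hi]; apply/forallP; case=> [[|[|[|[|j]]]] //= hj];
  by rewrite ?ltnn.
Qed.

Lemma has_pattern4 w x y z t :
  reflect (exists a b c d, subseq [:: a; b; c; d] w /\
             order_iso [:: a; b; c; d] [:: x; y; z; t])
          (has_pattern [:: x; y; z; t] w).
Proof.
apply: (iffP (has_patternP _ _)) => [[s sw iso]|[a [b [c [d [sw iso]]]]]]; last first.
  by exists [:: a; b; c; d].
case: s sw iso => [|a [|b [|c [|d [|e s]]]]] sw iso //.
by exists a, b, c, d.
Qed.

Lemma avP w :
  reflect (forall a b c d : nat, subseq [:: a; b; c; d] w -> ~~ bad a b c d) (av w).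
Proof.
apply: (iffP idP) => [|h].
  rewrite /av /= andbT => /and3P[h1 h2 h3] a b c d sw; apply/negP.
  by case/or3P=> hb; [move/negP: h1 | move/negP: h2 | move/negP: h3];
    apply; apply/has_pattern4; exists a, b, c, d; split=> //;
    rewrite order_iso4; lia.
by rewrite /av /= andbT; apply/and3P; split; apply/negP;
  case/has_pattern4=> [a [b [c [d [/h]]]]]; rewrite order_iso4 /bad; lia.
Qed.

Lemma av_subseq v w : subseq v w -> av w -> av v.
Proof. by move=> vw /avP h; apply/avP => a b c d /subseq_trans/(_ vw); apply: h. Qed.

Lemma av_cons k w :
  reflect (av w /\ forall b c d, subseq [:: b; c; d] w -> ~~ bad k b c d)
          (av (k :: w)).
Proof.
apply: (iffP idP) => [h|[aw h]].
  split; first by apply: av_subseq h; apply: subseq_cons.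
  by move=> b c d bcd; move/avP: h; apply; rewrite /= eqxx.
apply/avP=> a b c d; rewrite /=; case: eqP => [-> |_]; first exact: h.
by move: aw => /avP; apply.
Qed.

(* The last letter of a forbidden pattern is never its maximum. *)
Lemma av_rcons_max s x : av s -> {in s, forall y, y < x} -> av (rcons s x).
Proof.
move=> /avP avs lt; apply/avP => a b c d; rewrite -cats1 subseq_catE.
rewrite [has _ _]/= !(fun_if (eq_op^~ _)) /= !if_same /= !andbF andbT /= orbF.
case/orP=> [/andP[abc]|/avs //]; case: eqP => // -> _.
have [ax cx] : a < x /\ c < x.
  by split; apply/lt/(mem_subseq abc); rewrite !inE eqxx ?orbT.
by rewrite /bad; lia.
Qed.

(** The letters of [t] are appended one at a time, each being a new maximum. *)
Lemma av_cat_max s t :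
  av s -> sorted ltn t -> {in s & t, forall x y, x < y} -> av (s ++ t).
Proof.
elim: t s => [|x t IHt] s avs st lt; first by rewrite cats0.
rewrite -cat_rcons; apply: IHt.
- by apply: av_rcons_max avs _ => y ys; apply: lt; rewrite ?mem_head.
- exact: path_sorted st.
move=> y z; rewrite mem_rcons inE => /predU1P[->|ys] zt.
  by move/(order_path_min ltn_trans)/allP: st; apply.
by apply: lt; rewrite // inE zt orbT.
Qed.

(** * Block shape of an avoider with a middle first letter *)

Lemma subseq_sorted_all (T : eqType) (r : rel T) (p : pred T) (t : seq T) :
  transitive r -> sorted r t -> all p t ->
  forall s, subseq s t -> sorted r s && all p s.
Proof.
move=> tr st pt s sub; rewrite (subseq_sorted tr sub st).
by apply/allP=> x /(mem_subseq sub); apply/allP.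
Qed.

(** A four-letter subsequence is shared out among the blocks [k], [A], [D1], [u], [D2], [B]; their
    monotonicity and relative heights exclude a forbidden pattern in every distribution. *)
Lemma av_hook k A D1 u D2 B :
  sorted gtn A -> sorted gtn (D1 ++ D2) -> sorted ltn B -> k < u ->
  all (gtn k) (D1 ++ D2) -> all (ltn u) (A ++ B) ->
  av (k :: A ++ (D1 ++ u :: D2) ++ B).
Proof.
move=> sA sD sB ku kD; rewrite all_cat => /andP[uA uB].
have tr : transitive gtn by move=> x y z /=; lia.
have hA := subseq_sorted_all tr sA uA.
have hB := subseq_sorted_all ltn_trans sB uB.
have hD := subseq_sorted_all tr sD kD.
(* Sortedness for the empty relation says that the subsequence has at most one letter. *)
have hx (x : nat) : forall s, subseq s [:: x] ->
    sorted (fun _ _ => false) s && all (pred1 x) s.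
  by apply: subseq_sorted_all; rewrite //= eqxx.
apply/avP => a b c d; rewrite -(cat1s k) -catA -(cat1s u) -(catA [:: u]).
(* Naming the singletons keeps [/=] from unfolding them, so that all six blocks are cut alike. *)
move: (hx k) (hx u); move: [:: k] [:: u] => K V hK hV.
rewrite !subseq_catE [has _ _]/= => H.
repeat match goal with
| H : is_true (_ && _) |- _ => case/andP: H => ? H
| H : is_true (_ || _) |- _ => case/orP: H => H
| H : is_true false |- _ => by []
| H : is_true (subseq _ (_ ++ _)) |- _ => rewrite subseq_catE [has _ _]/= in H
end;
match goal with
| H1 : is_true (subseq _ K), H2 : is_true (subseq _ A), H3 : is_true (subseq _ D1),
  H4 : is_true (subseq _ V), H5 : is_true (subseq _ D2), H6 : is_true (subseq _ B) |- _ =>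
  move: (hK _ H1) (hA _ H2) (hD _ (cat_subseq H3 H5)) (hV _ H4) (hB _ H6)
end; clear -ku; rewrite /= /bad; lia.
Qed.

Lemma subseq2_neq (T : eqType) (x y : T) s : uniq s -> subseq [:: x; y] s -> x != y.
Proof. by move=> us /subseq_uniq/(_ us); rewrite /= inE andbT. Qed.

Lemma hook_shape k u L U z :
  av (k :: z) -> k < u -> uniq z -> L != [::] ->
  all (gtn k) L -> all (ltn u) U -> perm_eq z (L ++ u :: U) ->
  exists A D1 D2 B,
    [/\ z = A ++ (D1 ++ u :: D2) ++ B, sorted gtn A /\ sorted ltn B,
        perm_eq (A ++ B) U /\ perm_eq (D1 ++ D2) L, sorted gtn D2
      & A != [::] -> sorted gtn (D1 ++ D2)].
Proof.
move=> /av_cons[_ avz] ku uz L0 kL uU pz.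
have mz x : x \in z -> [|| x < k, x == u | u < x].
  rewrite (perm_mem pz) mem_cat inE => /or3P[/(allP kL) /=->|->|/(allP uU) /=->] //;
  by rewrite ?orbT.
have uinz : u \in z by rewrite (perm_mem pz) mem_cat mem_head orbT.
(* The word is cut at its first and last letters that are at most [u]: [A] is the prefix before
   [c0], [B] the suffix after [c1], both made of letters above [u]. *)
have /split_first[A [c0 [s [zE c0u uA]]]] : has (fun x => x <= u) z.
  by apply/hasP; exists u.
have /split_last[s1 [c1 [B [sE c1u uB]]]] : has (fun x => x <= u) (c0 :: s).
  by rewrite /= c0u.
set C := rcons s1 c1; have zE' : z = A ++ C ++ B by rewrite zE sE /C cat_rcons.
have uC : u \in C.
  move: uinz; rewrite zE' !mem_cat => /or3P[/(allP uA)|//|/(allP uB)];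
  by rewrite /= leqnn.
have sub_z X : subseq X C -> subseq X z.
  move=> h; rewrite zE'; apply: subseq_trans h _.
  by apply: subseq_trans (prefix_subseq _ _) (suffix_subseq _ _).
have uniqC : uniq C by apply: subseq_uniq uz; apply: sub_z.
have C_le : all (fun x => x <= u) C.
  apply/allP => x xC; rewrite leqNgt; apply/negP => ux.
  have [X1 [X2 CE]] : exists X1 X2, C = X1 ++ x :: X2.
    by case/splitPr: xC => X1 X2; exists X1, X2.
  have c0X : c0 \in X1.
    case: X1 CE => [|y X1] CE; move: sE; rewrite -cat_rcons -/C CE => -[e _].
      by move: c0u; rewrite e leqNgt ux.
    by rewrite e mem_head.
  have c1X : c1 \in X2.
    case/lastP: X2 CE => [|X2 y]; rewrite /C.
      by rewrite cats1 => /rcons_inj[_ e]; move: c1u; rewrite e leqNgt ux.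
    by rewrite -rcons_cons -rcons_cat => /rcons_inj[_ ->]; rewrite mem_rcons mem_head.
  have sub3 y t : y \in X1 -> t \in X2 -> subseq [:: y; x; t] z.
    move=> yX tX; apply: sub_z; rewrite CE -(cat1s y); apply: cat_subseq.
      by rewrite sub1seq.
    by rewrite /= eqxx sub1seq.
  have mX y t : y \in X1 -> t \in X2 -> [&& y \in z, t \in z & y != t].
    move=> yX tX; rewrite !(mem_subseq (sub3 _ _ yX tX)) ?inE ?eqxx ?orbT //=.
    move: (subseq_uniq (sub3 _ _ yX tX) uz); rewrite /= !inE negb_or.
    by case/and3P=> /andP[].
  (* If [u] precedes [x], then [c1 < k] and [k u x c1] is a 2341; if [u] follows [x], then [c0 < k]
     and [k c0 x u] is a 2143. *)
  move: uC; rewrite CE mem_cat inE => /or3P[uX|/eqP e|uX].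
  - have /and3P[_ c1z neq] := mX _ _ uX c1X.
    move: (avz _ _ _ (sub3 _ _ uX c1X)) (mz _ c1z) neq ux ku c1u; clear.
    by rewrite /bad; lia.
  - by rewrite e ltnn in ux.
  - have /and3P[c0z _ neq] := mX _ _ c0X uX.
    move: (avz _ _ _ (sub3 _ _ c0X uX)) (mz _ c0z) neq ux ku c0u; clear.
    by rewrite /bad; lia.
have pC : perm_eq C (rcons L u).
  have := perm_filter (fun x => x <= u) pz; rewrite zE' !filter_cat /= leqnn.
  have f0 S : all (ltn u) S -> [seq x <- S | x <= u] = [::].
    by move=> h; apply/eqP; rewrite -[_ == _]negbK -has_filter -all_predC;
      apply: sub_all h => x /=; rewrite ltnNge.
  have f1 S : all (fun x => x <= u) S -> [seq x <- S | x <= u] = S by move/all_filterP.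
  rewrite (f1 _ C_le) !(f0 A, f0 B, f0 U) ?cats0 //=; first last.
  - by apply: sub_all uA => x /=; rewrite ltnNge.
  - by apply: sub_all uB => x /=; rewrite ltnNge.
  rewrite f1 ?cats1 //; apply: sub_all kL => x /=; lia.
have pAB : perm_eq (A ++ B) U.
  have h : perm_eq (C ++ A ++ B) (rcons L u ++ U) by rewrite cat_rcons perm_catCA -zE'.
  by rewrite -(perm_cat2l (rcons L u)) -(permPr h) perm_cat2r perm_sym.
have [l lL] : exists l, l \in L by case: (L) L0 => // l ? _; exists l; rewrite mem_head.
have lC : l \in C by rewrite (perm_mem pC) mem_rcons inE lL orbT.
have lk := allP kL _ lL.
have uAB x : x \in A ++ B -> u < x by rewrite (perm_mem pAB) => /(allP uU).
move: (uC); case/splitPr CE: {1}C / uC => [D1 D2] _.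
have pD : perm_eq (D1 ++ D2) L.
  move: pC; rewrite CE -cats1 perm_sym perm_catC /= perm_sym.
  by rewrite (perm_catCA _ [:: u]) perm_cons.
have kD : {in D1 ++ D2, forall x, x < k} by move=> x; rewrite (perm_mem pD) => /(allP kL).
exists A, D1, D2, B; split=> //.
- by rewrite -CE.
(* An ascent [x < y] in [A] makes [k x y l] a 2341, and a descent [x > y] in [B] makes [k l x y] a
   2143. *)
- split; apply: sorted_subseq2 => x y xy.
  + have sz : subseq [:: x; y; l] z.
      rewrite zE' (cat_subseq xy (s2 := [:: l])) // sub1seq mem_cat lC //.
    have xA : x \in A ++ B by rewrite mem_cat (mem_subseq xy) ?mem_head.
    have yA : y \in A ++ B by rewrite mem_cat (mem_subseq xy) // !inE eqxx orbT.
    move: (avz _ _ _ sz) (uAB _ xA) (uAB _ yA) lk.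
    have : x != y.
      by apply: subseq2_neq uz _; apply: subseq_trans sz; rewrite /= !eqxx.
    clear -ku; rewrite /bad /=; lia.
  + have sz : subseq [:: l; x; y] z.
      rewrite zE' catA; apply: (cat_subseq (s1 := [:: l])) xy.
      by rewrite sub1seq mem_cat lC orbT.
    have xA : x \in A ++ B by rewrite mem_cat (mem_subseq xy) ?mem_head ?orbT.
    have yA : y \in A ++ B by rewrite mem_cat (mem_subseq xy) ?orbT // !inE eqxx orbT.
    move: (avz _ _ _ sz) (uAB _ xA) (uAB _ yA) lk.
    have : x != y.
      by apply: subseq2_neq uz _; apply: subseq_trans sz; apply: subseq_cons.
    clear -ku; rewrite /bad /=; lia.
(* Here [x < y] would make [k u x y] a 3412. *)
- apply: sorted_subseq2 => x y xy.
  have sz : subseq [:: u; x; y] z.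
    apply: sub_z; rewrite CE; apply: subseq_trans (suffix_subseq _ _).
    by rewrite /= eqxx.
  have xD : x \in D1 ++ D2 by rewrite mem_cat (mem_subseq xy) ?mem_head ?orbT.
  have yD : y \in D1 ++ D2 by rewrite mem_cat (mem_subseq xy) ?orbT // !inE eqxx orbT.
  move: (avz _ _ _ sz) (kD _ xD) (kD _ yD).
  have : x != y.
    by apply: subseq2_neq uz _; apply: subseq_trans sz; apply: subseq_cons.
  clear -ku; rewrite /bad /=; lia.
(* A letter [a] of [A] replaces [u] in the 3412, and it precedes [D1] as well as [D2]. *)
case: (A) zE' uAB => // a A' zE' uAB _; apply: sorted_subseq2 => x y xy.
have ua : u < a by apply: uAB; rewrite mem_head.
have sz : subseq [:: a; x; y] z.
  rewrite zE' /= eqxx; apply: subseq_trans xy _; rewrite CE.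
  apply: subseq_trans (suffix_subseq _ _); apply: subseq_trans (prefix_subseq _ _).
  by apply: cat_subseq => //; apply: subseq_cons.
have xD : x \in D1 ++ D2 by rewrite (mem_subseq xy) ?mem_head.
have yD : y \in D1 ++ D2 by rewrite (mem_subseq xy) // !inE eqxx orbT.
move: (avz _ _ _ sz) (kD _ xD) (kD _ yD) ua.
have : x != y.
  by apply: subseq2_neq uz _; apply: subseq_trans sz; apply: subseq_cons.
clear -ku; rewrite /bad /=; lia.
Qed.

(** * Words by first letter *)

Lemma gtn_trans : transitive gtn.
Proof. by move=> x y z /= yx xz; apply: ltn_trans xz yx. Qed.

Lemma filter_leq_gt t s : all (ltn t) s -> [seq x <- s | x <= t] = [::].
Proof. by elim: s => //= x s IHs; rewrite ltnNge => /andP[/negbTE->]. Qed.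

(** When [U] is increasing, each of its letters in turn joins the front or the end of the growing
    core, so the front part becomes decreasing and the end part increasing. *)
Fixpoint hook (c U : seq nat) : seq (seq nat) :=
  if U is u :: U' then hook (u :: c) U' ++ hook (rcons c u) U' else [:: c].

Lemma size_hook c U : size (hook c U) = 2 ^ size U.
Proof. by elim: U c => //= u U IHU c; rewrite size_cat !IHU expnS mul2n addnn. Qed.

(** The least letter [u] of [U] is either the last letter of [A] or the first of [B]; in both cases
    it is adjacent to [c] and can be absorbed into the core. *)
Lemma mem_hook c U z : sorted ltn U ->
  z \in hook c U <->
  exists A B, [/\ z = A ++ c ++ B, sorted gtn A, sorted ltn B & perm_eq (A ++ B) U].
Proof.
elim: U c => [|u U IHU] c sU /=.
  rewrite inE; split=> [/eqP->|[A [B [-> _ _ /perm_nilP]]]].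
    by exists [::], [::]; rewrite cats0.
  by case: A B => [|? ?] [|? ?] //=; rewrite cats0.
have uU : all (ltn u) U by apply: (order_path_min ltn_trans).
have sU' := path_sorted sU.
rewrite mem_cat; split.
  case/orP=> /(IHU _ sU')[A [B [-> sA sB pAB]]];
    move: (perm_all (ltn u) pAB); rewrite uU all_cat => /andP[uA uB].
  - exists (rcons A u), B; rewrite cat_rcons; split=> //.
      rewrite -rev_sorted rev_rcons /= (path_sortedE ltn_trans) all_rev uA /=.
      by rewrite rev_sorted.
    by rewrite cat_rcons -(cat1s u B) perm_catCA perm_cons.
  - exists A, (u :: B); split=> //; first by rewrite cat_rcons.
      by rewrite /= (path_sortedE ltn_trans) uB.
    by rewrite -(cat1s u B) perm_catCA perm_cons.
case=> A [B [zE sA sB pAB]].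
have : u \in A ++ B by rewrite (perm_mem pAB) mem_head.
have leU x : x \in A ++ B -> u <= x.
  by rewrite (perm_mem pAB) inE => /predU1P[->|/(allP uU)/ltnW].
rewrite mem_cat => /orP[uA|uB]; apply/orP; [left|right]; apply/(IHU _ sU').
- case/lastP: A => [|A a] in zE sA pAB leU uA *; first by [].
  have ae : a = u.
    move: uA sA; rewrite mem_rcons inE -rev_sorted rev_rcons /=.
    rewrite (path_sortedE ltn_trans) => /predU1P[->//|uA] /andP[/allP h _].
    have := h u; rewrite mem_rev uA => /(_ isT) /=.
    by rewrite ltnNge leU // mem_cat mem_rcons mem_head.
  exists A, B; split=> //; first by rewrite zE ae cat_rcons.
    by move: sA; rewrite -cats1; apply: subseq_sorted (prefix_subseq _ _); apply: gtn_trans.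
  by rewrite -(perm_cons u) -(permPr pAB) perm_sym ae cat_rcons -(cat1s u B) perm_catCA.
- case: B => [|b B] in zE sB pAB leU uB *; first by [].
  have be : b = u.
    move: uB sB; rewrite inE /= (path_sortedE ltn_trans).
    case/predU1P=> [->//|uB] /andP[/allP h _].
    by have /= := h u uB; rewrite ltnNge leU // mem_cat mem_head orbT.
  exists A, B; split=> //; first by rewrite zE be cat_rcons.
    exact: path_sorted sB.
  by rewrite -(perm_cons u) -(permPr pAB) perm_sym be -(cat1s u B) perm_catCA.
Qed.

Lemma filter_hook t c U z : sorted ltn U -> all (geq t) c -> all (ltn t) U ->
  z \in hook c U -> [seq x <- z | x <= t] = c.
Proof.
move=> sU tc tU /(mem_hook _ _ sU)[A [B [-> _ _ pAB]]].
move: (perm_all (ltn t) pAB); rewrite tU all_cat => /andP[tA tB].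
by rewrite !filter_cat (filter_leq_gt tA) (filter_leq_gt tB) cats0; apply/all_filterP.
Qed.

(** The two recursive calls have the cores [u :: c] and [rcons c u], which differ because [c] has a
    letter and all its letters are below [u]; [filter_hook] recovers the core from the word. *)
Lemma hook_uniq c U : sorted ltn U -> c != [::] ->
  {in c & U, forall x y, x < y} -> uniq (hook c U).
Proof.
elim: U c => //= u U IHU c sU c0 cU.
have sU' := path_sorted sU.
have uU : all (ltn u) U by apply: (order_path_min ltn_trans).
have cu x : x \in c -> x < u by move=> xc; apply: cU; rewrite ?mem_head.
have c'u x : x \in u :: c -> x <= u by rewrite inE => /predU1P[->//|/cu/ltnW].
rewrite cat_uniq !IHU //=; last 3 first.
- by case: (c).
- by move=> x y; rewrite mem_rcons => /c'u xu /(allP uU); apply: leq_ltn_trans.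
- by move=> x y /c'u xu /(allP uU); apply: leq_ltn_trans.
rewrite andbT; apply/hasPn => z zr; apply/negP => zl.
have := filter_hook sU' (introT allP c'u) uU zl.
rewrite (filter_hook sU' _ uU zr); last by apply/allP => x; rewrite mem_rcons => /c'u.
case: (c) c0 cu => // x c' _ cu [] xu.
by have := cu x (mem_head _ _); rewrite xu ltnn.
Qed.

(** The removed word is the one with [A] empty, a case that allows more cores [c] and is counted
    apart. *)
Definition hooked c U := rem (c ++ U) (hook c U).

Lemma hook_trivial c U : sorted ltn U -> c ++ U \in hook c U.
Proof. by move=> sU; apply/mem_hook => //; exists [::], U. Qed.

Lemma size_hooked c U : sorted ltn U -> size (hooked c U) = (2 ^ size U).-1.
Proof. by move=> sU; rewrite size_rem ?hook_trivial // size_hook. Qed.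

Lemma mem_hooked c U z : sorted ltn U -> c != [::] ->
  {in c & U, forall x y, x < y} ->
  z \in hooked c U <->
  exists A B, [/\ z = A ++ c ++ B, A != [::], sorted gtn A, sorted ltn B
                & perm_eq (A ++ B) U].
Proof.
move=> sU c0 cU; rewrite mem_rem_uniq ?hook_uniq // inE; split.
  case/andP=> nz /(mem_hook _ _ sU)[A [B [zE sA sB pAB]]].
  exists A, B; split=> //; apply: contraNneq nz => A0.
  move: zE pAB; rewrite A0 => -> /= pBU.
  by rewrite (irr_sorted_eq ltn_trans ltnn sB sU (perm_mem pBU)).
case=> A [B [zE A0 sA sB pAB]]; apply/andP; split; last first.
  by apply/mem_hook => //; exists A, B.
case: A A0 zE pAB sA => // a A _ -> pAB _.
case: c c0 cU => // x c _ cU; apply/eqP => -[ax _].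
have := cU x a (mem_head _ _); rewrite -(perm_mem pAB) mem_head => /(_ isT).
by rewrite ax ltnn.
Qed.

(** With [k] as 2, both 2143 and 2341 need two letters above [k], but only [u] is available; with
    [k] as 3, 3412 needs an ascent below [k] after [u], but [D2] is decreasing. *)
Lemma av_cons_peak k D1 u D2 :
  av (D1 ++ u :: D2) -> k < u -> all (gtn k) (D1 ++ D2) -> sorted gtn D2 ->
  av (k :: D1 ++ u :: D2).
Proof.
move=> avz ku; rewrite all_cat => /andP[kD1 kD2] sD2.
apply/av_cons; split=> // b c d.
have h1 s (sub : subseq s D1) : all (gtn k) s.
  by apply/allP=> x /(mem_subseq sub); apply/allP.
have h2 := subseq_sorted_all gtn_trans sD2 kD2.
have hx : forall s, subseq s [:: u] -> sorted (fun _ _ => false) s && all (pred1 u) s.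
  by apply: subseq_sorted_all; rewrite //= eqxx.
rewrite -(cat1s u); move: hx; move: [:: u] => V hV.
rewrite !subseq_catE [has _ _]/= => H.
repeat match goal with
| H : is_true (_ && _) |- _ => case/andP: H => ? H
| H : is_true (_ || _) |- _ => case/orP: H => H
| H : is_true false |- _ => by []
| H : is_true (subseq _ (_ ++ _)) |- _ => rewrite subseq_catE [has _ _]/= in H
end;
match goal with
| H1 : is_true (subseq _ D1), H2 : is_true (subseq _ V), H3 : is_true (subseq _ D2) |- _ =>
  move: (h1 _ H1) (hV _ H2) (h2 _ H3)
end; clear -ku; rewrite /= /bad; lia.
Qed.

(** The offset [m] allows the least letter to be deleted without relabelling the others. *)
Definition avl m n := [seq w <- permutations (iota m n) | av w].

Lemma mem_avl m n w : (w \in avl m n) = av w && perm_eq w (iota m n).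
Proof. by rewrite mem_filter mem_permutations. Qed.

Lemma avl_uniq m n : uniq (avl m n).
Proof. exact/filter_uniq/permutations_uniq. Qed.

(** These are the cores [c] for empty [A]. The maximum [u] is a separate argument because the first
    letter [k = m + p] is missing from the core. *)
Definition clist m p u :=
  [seq v <- permutations (rcons (iota m p) u)
     | av v && sorted gtn (drop (index u v) v)].

Lemma clist_uniq m p u : uniq (clist m p u).
Proof. exact/filter_uniq/permutations_uniq. Qed.

Lemma sorted_gtn_cons x s : sorted gtn (x :: s) = all (gtn x) s && sorted gtn s.
Proof. exact/path_sortedE/gtn_trans. Qed.

Lemma mem_clist m p u v : m + p <= u ->
  v \in clist m p u <->
  exists D1 D2, [/\ v = D1 ++ u :: D2, av v, perm_eq (D1 ++ D2) (iota m p)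
                  & sorted gtn D2].
Proof.
move=> mpu; rewrite mem_filter mem_permutations; split.
  case/andP=> /andP[avv sv] pv.
  have uv : u \in v by rewrite (perm_mem pv) mem_rcons mem_head.
  have uqv : uniq v.
    rewrite (perm_uniq pv) rcons_uniq iota_uniq mem_iota andbT; lia.
  case/splitPr vE : {1}v / uv => [D1 D2].
  exists D1, D2; split=> //.
    by rewrite -(perm_cons u) -cat1s perm_catCA -vE (permPl pv) -cats1 perm_catC.
  move: uqv sv; rewrite vE cat_uniq => /and3P[_ /hasPn/(_ u (mem_head _ _)) nu _].
  by rewrite index_cat (negbTE nu) /= eqxx addn0 drop_size_cat // => /path_sorted.
case=> D1 [D2 [-> -> pD sD /=]].
have lu x : x \in D1 ++ D2 -> x < u by rewrite (perm_mem pD) mem_iota; lia.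
have nu : u \notin D1.
  by apply/negP => uD; have := lu u; rewrite mem_cat uD ltnn => /(_ isT).
rewrite index_cat (negbTE nu) /= eqxx addn0 drop_size_cat // -(cat1s u D2).
rewrite perm_catCA -cats1 perm_sym perm_catC perm_sym perm_cons pD andbT.
rewrite sorted_gtn_cons sD andbT.
by apply/allP => x xD; apply: lu; rewrite mem_cat xD orbT.
Qed.

Definition insert (u : nat) D i := take i D ++ u :: drop i D.

Lemma iota_middle m p r :
  iota m (p + r).+2 = iota m p ++ m + p :: (m + p).+1 :: iota (m + p).+2 r.
Proof. by rewrite -addnS -addnS iotaD. Qed.

(** Below [k = m + p] lie [p] letters, above [u] lie [r]. The first summand is the case of empty
    [A]; in the second, [u] has [p.+1] places among the decreasing low letters and [A] is any of the
    [2 ^ r - 1] nonempty subsets of [U]. *)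
Lemma count_middle m p r : 0 < p ->
  count (fun w => head 0 w == m + p) (avl m (p + r).+2) =
  size (clist m p (m + p).+1) + p.+1 * (2 ^ r).-1.
Proof.
move=> p_gt0; set k := m + p; set u := k.+1; set U := iota u.+1 r.
have sU : sorted ltn U by apply: iota_ltn_sorted.
have uU : all (ltn u) U by apply/allP => x; rewrite mem_iota; case/andP.
set L := iota m p; have kL : all (gtn k) L.
  by apply/allP => x; rewrite mem_iota; case/andP.
have uniqL : uniq L := iota_uniq _ _.
pose c1 := [seq c ++ U | c <- clist m p u].
pose c2 := flatten [seq hooked (insert u (rev L) i) U | i <- iota 0 p.+1].
have le_insert i : {in insert u (rev L) i, forall x, x <= u}.
  move=> x; rewrite mem_cat inE orbCA -mem_cat cat_take_drop mem_rev.
  by case/predU1P=> [->//|/(allP kL)]; rewrite /u /=; lia.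
have lt_insert i : {in insert u (rev L) i & U, forall x y, x < y}.
  by move=> x y /le_insert xu /(allP uU); apply: leq_ltn_trans.
have insert0 i : insert u (rev L) i != [::] by rewrite /insert; case: take.
have le_clist c : c \in clist m p u -> {in c, forall x, x <= u}.
  rewrite mem_filter mem_permutations => /andP[_ pc] x.
  by rewrite (perm_mem pc) mem_rcons inE => /predU1P[->//|/(allP kL)]; rewrite /u /=; lia.
have c2P z : z \in c2 <->
    exists A D1 D2 B, [/\ z = A ++ (D1 ++ u :: D2) ++ B, A != [::],
       sorted gtn A /\ sorted ltn B, perm_eq (A ++ B) U & D1 ++ D2 = rev L].
  split=> [/flatten_mapP[i _ /(mem_hooked _ sU (insert0 i) (@lt_insert i))]|].
    case=> A [B [-> A0 sA sB pAB]].
    by exists A, (take i (rev L)), (drop i (rev L)), B; rewrite cat_take_drop.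
  case=> A [D1 [D2 [B [-> A0 [sA sB] pAB eD]]]]; apply/flatten_mapP.
  have szD : size D1 <= p.
    by move: (congr1 size eD); rewrite size_rev size_iota size_cat => <-; apply: leq_addr.
  exists (size D1); first by rewrite mem_iota.
  apply/mem_hooked => //; exists A, B; split=> //.
  by rewrite /insert -eD take_size_cat // drop_size_cat.
(* The first letter tells the two families apart: it is at most [u] in [c1] and above [u] in
   [c2]. *)
have head_c1 z : z \in c1 -> head 0 z <= u.
  case/mapP=> c cc ->; have /(mem_clist _ (leqnSn k))[D1 [D2 [cE _ _ _]]] := cc.
  have := le_clist _ cc; rewrite cE.
  by case: D1 {cE} => [|x D1] //= h; apply: h; rewrite mem_head.
have head_c2 z : z \in c2 -> u < head 0 z.
  move/c2P=> [[|a A] [D1 [D2 [B [-> // _ _ pAB _]]]]] /=.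
  by apply: (allP uU); rewrite -(perm_mem pAB) mem_head.
have size_c2 : size c2 = p.+1 * (2 ^ r).-1.
  rewrite size_flatten /shape -map_comp.
  rewrite (eq_map (g := fun=> (2 ^ r).-1)) => [|i /=]; last first.
    by rewrite size_hooked // size_iota.
  by rewrite sumnE big_map big_const_seq count_predT size_iota iter_addn_0 mulnC.
rewrite -size_c2 -(size_map (cat^~ U)) -size_cat -size_filter.
rewrite -[RHS](size_map (cons k)); apply/perm_size/uniq_perm.
- exact/filter_uniq/avl_uniq.
- rewrite map_inj_uniq => [|x y [] //]; rewrite cat_uniq; apply/and3P; split.
  + rewrite map_inj_in_uniq ?clist_uniq // => x y xc yc /= /(congr1 (filter (geq u))).
    by rewrite !filter_cat (filter_leq_gt uU) !cats0 !(all_filterP _) //;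
      apply/allP; apply: le_clist.
  + by apply/hasPn => z /head_c2; rewrite ltnNge; apply: contra => /head_c1.
  (* The place of [u] among the letters at most [u] gives back the index [i]. *)
  + apply: (@uniq_flatten_key _ _ _ (fun z => index u [seq x <- z | x <= u])).
    * exact: iota_uniq.
    * by move=> i _; apply/rem_uniq/hook_uniq.
    move=> i; rewrite mem_iota => ip z /mem_rem zh.
    rewrite (filter_hook sU _ uU zh); last by apply/allP/le_insert.
    rewrite /insert index_cat; case: ifPn => [/mem_take|_].
      by rewrite mem_rev => /(allP kL); rewrite /u /=; lia.
    by rewrite /= eqxx addn0 size_takel // size_rev /L size_iota.
have catE z : perm_eq (k :: z) (iota m (p + r).+2) = perm_eq z (L ++ u :: U).
  by rewrite iota_middle -/k -/L -/U perm_sym -(cat1s k) perm_catCA perm_cons perm_sym.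
move=> w; rewrite mem_filter mem_avl.
apply/idP/mapP => [/and3P[/eqP hw avw pw]|[z zc ->]].
  case: w hw avw pw => [|k' z]; first by move=> _ _ /perm_size.
  rewrite [head _ _]/= => -> avw pw; exists z => //; rewrite catE in pw.
  have uz : uniq z.
    by move: (iota_uniq m (p + r).+2); rewrite -(perm_uniq (etrans (catE z) pw)) => /andP[].
  have L0 : L != [::] by rewrite -size_eq0 /L size_iota -lt0n.
  have [A [D1 [D2 [B [zE [sA sB] [pAB pD] sD2 sD]]]]] :=
    hook_shape avw (ltnSn k) uz L0 kL uU pw.
  rewrite mem_cat; case: (eqVneq A [::]) => [A0|A0]; apply/orP; [left|right].
    move: zE pAB; rewrite A0 /= => zE pBU.
    rewrite zE (irr_sorted_eq ltn_trans ltnn sB sU (perm_mem pBU)); apply: map_f.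
    apply/mem_clist; first exact: leqnSn.
    exists D1, D2; split=> //; apply: av_subseq avw.
    by rewrite zE; apply: subseq_trans (prefix_subseq _ _) (subseq_cons _ _).
  apply/c2P; exists A, D1, D2, B; split=> //.
  apply: (irr_sorted_eq gtn_trans ltnn (sD A0)) => [|x].
    by rewrite rev_sorted iota_ltn_sorted.
  by rewrite mem_rev (perm_mem pD).
rewrite /= eqxx /= catE; move: zc; rewrite mem_cat => /orP[/mapP[c cc ->]|/c2P].
  have /(mem_clist _ (leqnSn k))[D1 [D2 [cE avc pD sD]]] := cc.
  rewrite -cat_rcons perm_cat2r; apply/andP; split; last first.
    by move: cc; rewrite mem_filter mem_permutations => /andP[].
  rewrite -cat_cons; apply: av_cat_max => //.
    rewrite cE; apply: av_cons_peak => //; first by rewrite -cE.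
    by rewrite (perm_all _ pD).
  move=> x y; rewrite inE => xc /(allP uU); apply: leq_ltn_trans.
  by case/predU1P: xc => [->|/(le_clist _ cc)] //; apply: leqnSn.
case=> A [D1 [D2 [B [-> A0 [sA sB] pAB eD]]]]; apply/andP; split.
  apply: av_hook => //.
  - by rewrite eD rev_sorted iota_ltn_sorted.
  - by rewrite eD all_rev.
  - by rewrite (perm_all _ pAB).
rewrite perm_catCA -(cat_rcons u L); apply: perm_cat => //.
rewrite -(cat1s u D2) perm_catCA -cats1 perm_sym perm_catC perm_sym perm_cons.
by rewrite eD perm_rev.
Qed.

Lemma uniq_cat_pred (T : eqType) (p : pred T) (s1 s2 : seq T) :
  all p s1 -> all (predC p) s2 -> uniq s1 -> uniq s2 -> uniq (s1 ++ s2).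
Proof.
move=> ps1 ps2 us1 us2; rewrite cat_uniq us1 us2 andbT /=.
by apply/hasPn => x /(allP ps2); apply: contra => /(allP ps1).
Qed.

Lemma size_sum_key (T : Type) (f : T -> nat) (s : seq T) n :
  all (fun x => f x < n) s -> size s = \sum_(i < n) count (fun x => f x == i) s.
Proof.
elim: s => [|x s IHs] /=; first by rewrite big1.
case/andP=> fx /IHs ->; rewrite big_split /= -[in LHS]add1n; congr (_ + _).
rewrite (bigD1 (Ordinal fx)) //= eqxx big1 // => i.
by rewrite -val_eqE /= eq_sym => /negbTE->.
Qed.

(** None of the three patterns begins with its least letter. *)
Lemma av_cons_min k w : av w -> all (ltn k) w -> av (k :: w).
Proof.
move=> avw kw; apply/av_cons; split=> // b c d /mem_subseq sub.
have lt x : x \in [:: b; c; d] -> k < x by move=> /sub/(allP kw).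
have := (lt b, lt c, lt d); rewrite !inE !eqxx !orbT.
case=> [[/(_ isT) ? /(_ isT) ?] /(_ isT) ?].
by rewrite /bad; lia.
Qed.

(** None of the three patterns begins with its greatest letter. *)
Lemma av_cons_max k w : av w -> all (gtn k) w -> av (k :: w).
Proof.
move=> avw kw; apply/av_cons; split=> // b c d /mem_subseq sub.
have lt x : x \in [:: b; c; d] -> x < k by move=> /sub/(allP kw).
have := (lt b, lt c, lt d); rewrite !inE !eqxx !orbT.
case=> [[/(_ isT) ? /(_ isT) ?] /(_ isT) ?].
by rewrite /bad; lia.
Qed.

(** Each of the three patterns has an ascent after its first letter. *)
Lemma av_cons_dec k w : sorted gtn w -> av (k :: w).
Proof.
move=> sw; apply/av_cons; split; first apply/avP => a.
all: by move=> b c d /(subseq_sorted gtn_trans)/(_ sw) /=; rewrite /bad; lia.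
Qed.

Lemma count_head m n : count (fun w => head 0 w == m) (avl m n.+1) = size (avl m.+1 n).
Proof.
rewrite -size_filter -[RHS](size_map (cons m)); apply/perm_size/uniq_perm.
- exact/filter_uniq/avl_uniq.
- by rewrite map_inj_uniq ?avl_uniq // => x y [].
move=> w; rewrite mem_filter mem_avl; apply/idP/mapP.
  case: w => [/and3P[_ _ /perm_size]|k w] //= /and3P[/eqP->].
  by rewrite perm_cons => /av_cons[avw _] pw; exists w; rewrite // mem_avl avw.
case=> z; rewrite mem_avl => /andP[avz pz] -> /=; rewrite eqxx perm_cons pz andbT /=.
by apply: av_cons_min avz _; apply/allP => x; rewrite (perm_mem pz) mem_iota; case/andP.
Qed.

Lemma count_last m n :
  count (fun w => head 0 w == m + n) (avl m n.+1) = size (avl m n).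
Proof.
rewrite -size_filter -[RHS](size_map (cons (m + n))); apply/perm_size/uniq_perm.
- exact/filter_uniq/avl_uniq.
- by rewrite map_inj_uniq ?avl_uniq // => x y [].
have E z : perm_eq (m + n :: z) (iota m n.+1) = perm_eq z (iota m n).
  by rewrite -addn1 iotaD cats1 perm_sym perm_rcons perm_cons perm_sym.
move=> w; rewrite mem_filter mem_avl; apply/idP/mapP.
  case: w => [/and3P[_ _ /perm_size]|k w] //; rewrite [head _ _]/= => /and3P[/eqP->].
  by rewrite E => /av_cons[avw _] pw; exists w; rewrite // mem_avl avw.
case=> z; rewrite mem_avl => /andP[avz pz] ->; rewrite E pz eqxx andbT /=.
by apply: av_cons_max avz _; apply/allP => x; rewrite (perm_mem pz) mem_iota; case/andP.
Qed.

Lemma size_avl0 m : size (avl m 0) = 1.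
Proof.
have: perm_eq (avl m 0) [:: [::]].
  apply: uniq_perm => [||w]; rewrite ?avl_uniq // mem_avl inE.
  by apply/andP/eqP => [[_ /perm_nilP]|->] //; split=> //; apply/avP.
by move/perm_size.
Qed.

Lemma size_avl1 m : size (avl m 1) = 1.
Proof.
rewrite (@size_sum_key _ (fun w => head 0 w - m) _ 1).
  rewrite big_ord1 -[RHS](size_avl0 m.+1) -count_head; apply: eq_in_count => w.
  rewrite mem_avl => /andP[_]; case: w => [/perm_size|k w pw] //=.
  have: k \in iota m 1 by rewrite -(perm_mem pw) mem_head.
  by rewrite mem_iota; lia.
apply/allP => w; rewrite mem_avl => /andP[_]; case: w => [/perm_size|k w pw] //=.
have: k \in iota m 1 by rewrite -(perm_mem pw) mem_head.
by rewrite mem_iota; lia.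
Qed.

Lemma size_avlSS m n :
  size (avl m n.+2) = size (avl m.+1 n.+1) + size (avl m n.+1)
    + \sum_(1 <= p < n.+1) (size (clist m p (m + p).+1) + p.+1 * (2 ^ (n - p)).-1).
Proof.
have headP w : w \in avl m n.+2 -> m <= head 0 w < m + n.+2.
  rewrite mem_avl => /andP[_]; case: w => [/perm_size|k w pw] //.
  by rewrite -mem_iota -(perm_mem pw) mem_head.
(* The key is the offset of the first letter; by [headP] the truncated subtraction is exact. *)
rewrite (@size_sum_key _ (fun w => head 0 w - m) _ n.+2); last first.
  by apply/allP => w /headP; lia.
rewrite (eq_bigr (fun i : 'I_n.+2 => count (fun w => head 0 w == m + i) (avl m n.+2)));
  last by move=> i _; apply: eq_in_count => w /headP; lia.
rewrite -(big_mkord xpredT (fun i => count (fun w => head 0 w == m + i) (avl m n.+2))).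
(* The extreme offsets [n.+1] and [0] are split off; at a middle offset [p], [n - p] letters lie
   above [u]. *)
rewrite big_nat_recr //= big_ltn // addn0 count_head count_last addnAC.
congr (_ + _); apply: eq_big_nat => p /andP[p_gt0 pn].
by rewrite -count_middle // subnKC.
Qed.

(** * Cores that do not end with their maximum *)

Definition blist m p u := [seq v <- clist m p u | last 0 v != u].

Lemma mem_blist m p u v : m + p <= u ->
  v \in blist m p u <->
  exists D1 D2, [/\ v = D1 ++ u :: D2, av v, perm_eq (D1 ++ D2) (iota m p),
                    sorted gtn D2 & D2 != [::]].
Proof.
move=> mpu; rewrite mem_filter; split.
  case/andP=> lv /(mem_clist _ mpu)[D1 [D2 [vE avv pD sD]]].
  exists D1, D2; split=> //; apply: contraNneq lv => D20.
  by rewrite vE D20 last_cat.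
case=> D1 [D2 [vE avv pD sD D20]]; apply/andP; split; last first.
  by apply/mem_clist => //; exists D1, D2.
rewrite vE last_cat; case/lastP: D2 D20 pD {vE sD} => // D2 x _ pD.
have: x \in iota m p by rewrite -(perm_mem pD) mem_cat mem_rcons mem_head orbT.
by rewrite last_cons last_rcons mem_iota; lia.
Qed.

(** Deleting a final [u] leaves an arbitrary avoider, since appending a maximum creates no forbidden
    pattern. *)
Lemma size_clist m p u : m + p <= u ->
  size (clist m p u) = size (avl m p) + size (blist m p u).
Proof.
move=> mpu; rewrite -(count_predC (fun v => last 0 v == u)) (size_filter _ (clist m p u)).
congr (_ + _); rewrite -size_filter -[RHS](size_map (rcons^~ u)).
apply/perm_size/uniq_perm.
- exact/filter_uniq/clist_uniq.
- by rewrite map_inj_uniq ?avl_uniq //; apply: rcons_injl.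
move=> v; rewrite mem_filter; apply/idP/mapP.
  case/andP=> /eqP lv /(mem_clist _ mpu)[D1 [D2 [vE avv pD sD]]].
  have D20 : D2 = [::].
    case/lastP: D2 vE pD {sD} => // D2 x vE pD.
    have: x \in iota m p by rewrite -(perm_mem pD) mem_cat mem_rcons mem_head orbT.
    by move: lv; rewrite vE last_cat last_cons last_rcons => ->; rewrite mem_iota; lia.
  exists D1; last by rewrite vE D20 cats1.
  rewrite D20 cats0 in pD; rewrite mem_avl pD andbT.
  by apply: av_subseq avv; rewrite vE prefix_subseq.
case=> w; rewrite mem_avl => /andP[avw pw] ->; rewrite last_rcons eqxx /=.
apply/mem_clist => //; exists w, [::]; rewrite cats0 cats1; split=> //.
apply: av_rcons_max avw _ => y; rewrite (perm_mem pw) mem_iota; lia.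
Qed.

Lemma size_blist1 m u : m < u -> size (blist m 1 u) = 1.
Proof.
move=> mu; have: perm_eq (blist m 1 u) [:: [:: u; m]]; last by move/perm_size.
apply: uniq_perm => [||v] //; first exact/filter_uniq/clist_uniq.
rewrite inE; apply/idP/eqP => [/mem_blist|->].
  rewrite addn1 => /(_ mu)[D1 [D2 [-> _ pD _]]].
  have := perm_size pD; rewrite size_cat; case: D2 pD => // x [|? ?] /=; case: D1 => //.
  - by move/perm_mem/(_ x); rewrite !inE eqxx => /esym/eqP->.
  - by move=> ? ? _; rewrite addn1.
  - by move=> ? ? ? ? _; lia.
apply/mem_blist; first by rewrite addn1.
by exists [::], [:: m]; split=> //; apply: av_cons_dec.
Qed.

Lemma sorted_gtn_rev_iota m n s :
  sorted gtn s -> perm_eq s (iota m n) -> s = rev (iota m n).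
Proof.
move=> ss ps; apply: (irr_sorted_eq gtn_trans ltnn ss) => [|x].
  by rewrite rev_sorted iota_ltn_sorted.
by rewrite mem_rev (perm_mem ps).
Qed.

(* Otherwise some letter before [u] and some letter after [u] complete [k] and
   [u] to 2143 or to 2341. *)
Lemma blist_first_middle m p u k D1 D2 : m + p <= u -> m < k < m + p.-1 ->
  av (k :: D1 ++ u :: D2) -> perm_eq (k :: D1 ++ D2) (iota m p) -> D2 != [::] ->
  D1 = [::].
Proof.
move=> mpu /andP[mk kp] /av_cons[_ avv] pD.
case: D2 avv pD => // x D2 avv pD _; case: D1 avv pD => // y D1 avv pD.
have sub (E1 E2 : seq nat) a b :
    a \in E1 -> b \in E2 -> subseq [:: a; u; b] (E1 ++ u :: E2).
  move=> aE bE; rewrite -(cat1s a); apply: cat_subseq; first by rewrite sub1seq.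
  by rewrite /= eqxx sub1seq.
have mD a : (a \in y :: D1) || (a \in x :: D2) -> (m <= a < m + p) && (a != k).
  rewrite -mem_cat => aD; rewrite -mem_iota -(perm_mem pD) inE aD orbT /=.
  move: (iota_uniq m p); rewrite -(perm_uniq pD) => /andP[kD _].
  by apply: contraNneq kD => <-.
have mD' a : m <= a < m + p -> a != k -> (a \in y :: D1) || (a \in x :: D2).
  by rewrite -mem_iota -(perm_mem pD) inE mem_cat => /predU1P[->|//]; rewrite eqxx.
(* If [a < k < b], then [k a u b] is a 2143; if [b < k < a], it is a 2341. *)
have ord a b (aD : a \in y :: D1) (bD : b \in x :: D2) : (a < k) = (b < k).
  have := avv _ _ _ (sub _ _ _ _ aD bD).
  have := mD a; rewrite aD => /(_ isT); have := mD b; rewrite bD orbT => /(_ isT).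
  by clear -mpu; rewrite /bad; lia.
have yD : y \in y :: D1 by rewrite mem_head.
have xD : x \in x :: D2 by rewrite mem_head.
(* Comparison with [x] and [y] puts all letters of [D1] and [D2] on one side of [k], yet the least
   letter [m] and the greatest [(m + p).-1] lie on opposite sides. *)
have := mD' m; have := mD' (m + p).-1; have := ord _ _ yD xD.
have := ord _ m yD; have := ord _ (m + p).-1 yD.
have := ord m _ ^~ xD; have := ord (m + p).-1 _ ^~ xD.
case: (m \in y :: D1); case: ((m + p).-1 \in y :: D1);
case: (m \in x :: D2); case: ((m + p).-1 \in x :: D2); clear -mk kp => /=.
all: do ?[move/(_ isT)]; lia.
Qed.

(** The words are sorted by first letter. The least or the greatest letter below [u] can be deleted,
    leaving a word of the same kind; any other first letter forces the rest. *)
Lemma size_blistSS m p u : m + p.+2 <= u ->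
  size (blist m p.+2 u) =
  size (blist m.+1 p.+1 u) + size (blist m p.+1 u) + p.+1.
Proof.
move=> mpu; set L := iota m p.+2.
have ltL x : x \in L -> x < u by rewrite mem_iota; lia.
have ltn_rem k : sorted ltn (rem k L).
  by have := subseq_sorted ltn_trans (rem_subseq k L); apply; apply: iota_ltn_sorted.
(* Either [u] comes first and the rest decreases, or one of the [p] middle letters comes first, then
   [u], then the rest in decreasing order. *)
pose X3 := (u :: rev L) :: [seq k :: u :: rev (rem k L) | k <- iota m.+1 p].
have sX3 : size X3 = p.+1 by rewrite /= size_map size_iota.
rewrite -[X in _ = _ + X]sX3 -(size_map (cons m) (blist m.+1 _ _)).
rewrite -(size_map (cons (m + p.+1)) (blist m p.+1 u)).
rewrite -addnA -!size_cat; apply/perm_size/uniq_perm.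
- exact/filter_uniq/clist_uniq.
- apply: (@uniq_cat_pred _ (fun v => head 0 v == m)).
  + by apply/allP => v /mapP[w _ ->] /=.
  + apply/allP => v; rewrite mem_cat inE => /or3P[/mapP[w _ ->]|/eqP->|/mapP[k]] /=.
    * by lia.
    * by lia.
    * by rewrite mem_iota => ? -> /=; lia.
  + by rewrite map_inj_uniq => [|x y [] //]; apply/filter_uniq/clist_uniq.
  apply: (@uniq_cat_pred _ (fun v => head 0 v == m + p.+1)).
  + by apply/allP => v /mapP[w _ ->] /=.
  + apply/allP => v; rewrite inE => /predU1P[->|/mapP[k]] /=.
    * by lia.
    * by rewrite mem_iota => ? -> /=; lia.
  + by rewrite map_inj_uniq => [|x y [] //]; apply/filter_uniq/clist_uniq.
  rewrite /= map_inj_uniq ?iota_uniq ?andbT => [|x y [] //].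
  by apply/negP => /mapP[k]; rewrite mem_iota => ? [? _]; lia.
have first z : perm_eq (m :: z) L = perm_eq z (iota m.+1 p.+1) by rewrite /L /= perm_cons.
have last z : perm_eq (m + p.+1 :: z) L = perm_eq z (iota m p.+1).
  by rewrite /L -(addn1 p.+1) iotaD cats1 perm_sym perm_rcons perm_cons perm_sym.
move=> v; rewrite !mem_cat; apply/idP/or3P => [/(mem_blist _ mpu)|h].
  case=> -[|k D1] [D2 [-> avv pD sD D20]].
    by apply: Or33; rewrite (sorted_gtn_rev_iota sD pD) mem_head.
  have kL : k \in L by rewrite -(perm_mem pD) mem_head.
  have [km|km] := eqVneq k m.
    apply: Or31; rewrite km; apply: map_f; apply/mem_blist; first by lia.
    exists D1, D2; split=> //; first by have [] := av_cons _ _ avv.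
    by rewrite -first -km.
  have [kM|kM] := eqVneq k (m + p.+1).
    apply: Or32; rewrite kM; apply: map_f; apply/mem_blist; first by lia.
    exists D1, D2; split=> //; first by have [] := av_cons _ _ avv.
    by rewrite -last -kM.
  apply: Or33; rewrite inE; apply/orP; right; apply/mapP; exists k.
    by move: kL; rewrite !mem_iota; lia.
  have D10 : D1 = [::].
    apply: blist_first_middle mpu _ avv pD D20.
    by move: kL; rewrite mem_iota; lia.
  rewrite D10 /=; congr [:: _, _ & _].
  have pD2 : perm_eq D2 (rem k L).
    by rewrite -(perm_cons k) -(permPr (perm_to_rem kL)) -[D2]/([::] ++ D2) -D10.
  apply: (irr_sorted_eq gtn_trans ltnn sD) => [|x].
    by rewrite rev_sorted; apply: ltn_rem.
  by rewrite mem_rev (perm_mem pD2).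
apply/(mem_blist _ mpu); case: h => [/mapP[w /mem_blist h ->]|/mapP[w /mem_blist h ->]|].
- have {h} [|D1 [D2 [-> avv pD sD D20]]] := h; first by lia.
  exists (m :: D1), D2; split=> //; last by rewrite -/L first.
  apply: av_cons_min => //; apply/allP => x; rewrite mem_cat inE orbCA -mem_cat.
  by rewrite (perm_mem pD) mem_iota /=; lia.
- have {h} [|D1 [D2 [-> avv pD sD D20]]] := h; first by lia.
  exists (m + p.+1 :: D1), D2; split=> //; last by rewrite -/L last.
  apply: av_cons_peak => //; first by lia.
  by apply/allP => x; rewrite (perm_mem pD) mem_iota /=; lia.
rewrite inE => /predU1P[->|/mapP[k kL ->]].
  exists [::], (rev L); split; rewrite ?rev_sorted ?iota_ltn_sorted ?perm_rev //.
    by apply: av_cons_dec; rewrite rev_sorted iota_ltn_sorted.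
  by rewrite -size_eq0 size_rev size_iota.
have {}kL : k \in L by move: kL; rewrite !mem_iota; lia.
exists [:: k], (rev (rem k L)).
have sR : sorted gtn (rev (rem k L)).
  by rewrite rev_sorted; apply: ltn_rem.
split=> //.
- apply: av_cons_dec; rewrite sorted_gtn_cons sR andbT.
  by apply/allP => x; rewrite mem_rev => /mem_rem/ltL.
- by rewrite perm_sym (permPl (perm_to_rem kL)) perm_cons perm_sym perm_rev.
by rewrite -size_eq0 size_rev size_rem // size_iota.
Qed.

(** * Counting *)

(** By [size_blistSS] the quantity [size (blist m p.+1 u) + p.+2] doubles at each step, starting
    from 3. *)
Lemma size_blist m p u : m + p.+1 <= u ->
  (size (blist m p.+1 u) + p.+2).*2 = 3 * 2 ^ p.+1.
Proof.
elim: p m u => [|p IHp] m u mpu; first by rewrite size_blist1 // -addn1.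
rewrite size_blistSS //; have := IHp m.+1 u; have := IHp m u.
by rewrite !(expnS 2 p.+1) -!muln2; lia.
Qed.

(** Instead of a relabelling, strong induction on [size_avlSS]: the [blist] terms have a closed form
    free of [m]. *)
Lemma size_avl_shift m n : size (avl m n) = size (avl 0 n).
Proof.
elim/ltn_ind: n m => -[|[|n]] IHn m; rewrite ?size_avl0 ?size_avl1 //.
rewrite !size_avlSS !(IHn n.+1 _ m.+1, IHn n.+1 _ m, IHn n.+1 _ 1) //.
congr (_ + _); apply: eq_big_nat => -[//|p] /andP[_ pn].
rewrite (size_clist (leqnSn (m + p.+1))) (size_clist (leqnSn (0 + p.+1))).
rewrite (IHn p.+1 (ltnW pn) m); congr (_ + _ + _).
move: (size_blist (leqnSn (m + p.+1))) (size_blist (leqnSn (0 + p.+1))).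
by clear; lia.
Qed.

(** Writing [T n] for the sum, [2 ^ (j + 1) - 1 = 2 (2 ^ j - 1) + 1] gives [T (n + 1) = 2 T n +
    \sum_(1 <= p <= n) (p + 1)]. *)
Lemma sum_hooks n :
  (\sum_(1 <= p < n.+1) p.+1 * (2 ^ (n - p)).-1).*2 + n.+2 * n.+3 = 3 * 2 ^ n.+1.
Proof.
elim: n => [|n IHn]; first by rewrite big_geq.
rewrite big_nat_recr //= subnn muln0 addn0.
have -> : \sum_(1 <= p < n.+1) p.+1 * (2 ^ (n.+1 - p)).-1 =
    (\sum_(1 <= p < n.+1) p.+1 * (2 ^ (n - p)).-1).*2 + \sum_(1 <= p < n.+1) p.+1.
  rewrite -mul2n big_distrr -big_split; apply: eq_big_nat => p /andP[_ pn] /=.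
  rewrite subSn // expnS; case: (2 ^ (n - p)) (expn_gt0 2 (n - p)) => // x _.
  by rewrite (_ : (2 * x.+1).-1 = 2 * x + 1) /=; lia.
have : (\sum_(1 <= p < n.+1) p.+1).*2 = n * n.+3.
  elim: (n) => [|k IHk]; first by rewrite big_geq.
  by rewrite big_nat_recr //= doubleD IHk; lia.
rewrite (expnS 2 n.+1); lia.
Qed.

(** Subtracting consecutive instances of [size_avlSS] cancels the sum [S] over earlier terms;
    [size_blist] and [sum_hooks] evaluate what is left. *)
Lemma avl_recurrence m n :
  size (avl m n.+2) + size (avl m n) + n.*2 + 3 = 3 * size (avl m n.+1) + 3 * 2 ^ n.
Proof.
rewrite !(size_avl_shift m).
pose S n := \sum_(1 <= p < n.+1) (size (avl 0 p) + size (blist 0 p p.+1)).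
have sumE k : size (avl 0 k.+2) = (size (avl 0 k.+1)).*2 + S k
    + \sum_(1 <= p < k.+1) p.+1 * (2 ^ (k - p)).-1.
  rewrite size_avlSS (size_avl_shift 1) addnn -addnA; congr (_ + _).
  rewrite -big_split; apply: eq_big_nat => p _ /=.
  by rewrite add0n size_clist.
(* For [n = 0] there is no preceding instance, but both sums are empty. *)
case: n => [|n].
  by rewrite sumE /S !big_geq // size_avl0 size_avl1.
rewrite (sumE n.+1) /S big_nat_recr //= -/(S n).
have := sumE n; have := sum_hooks n; have := sum_hooks n.+1.
have := @size_blist 0 n _ (leqnSn _); rewrite add0n !expnS; lia.
Qed.

(** * From permutations to words *)

Lemma one_line_inj n : injective (@one_line n).
Proof.
move=> p q e; apply/permP => i; apply/val_inj/succn_inj.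
by have /eq_in_map/(_ i) := e; apply; rewrite mem_enum.
Qed.

Lemma perm_one_line n (p : 'S_n) : perm_eq (one_line p) (iota 1 n).
Proof.
apply: uniq_perm; rewrite ?iota_uniq //.
  by rewrite map_inj_uniq ?enum_uniq // => i j [] /val_inj/perm_inj.
move=> x; rewrite mem_iota add1n ltnS; apply/mapP/idP => [[i _ ->]|/andP[x0 xn]].
  by rewrite ltn_ord.
have xn' : x.-1 < n by rewrite prednK.
by exists ((p^-1)%g (Ordinal xn')); rewrite ?mem_enum // permKV /= prednK.
Qed.

Lemma card_avoiders n : #|avoiders forbidden n| = size (avl 1 n).
Proof.
rewrite cardE -(size_map (@one_line n)); apply/perm_size/uniq_perm.
- by rewrite map_inj_uniq ?enum_uniq //; apply: one_line_inj.
- exact: avl_uniq.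
move=> w; rewrite mem_avl; apply/mapP/andP => [[p]|[avw pw]].
  by rewrite mem_enum inE => avp ->; split; [exact: avp | exact: perm_one_line].
(* Surjectivity by counting: the [n!] distinct one-line words lie in a list of length [n!]. *)
have [_ e] : size (map (@one_line n) (enum 'S_n)) = size (permutations (iota 1 n)) /\
    map (@one_line n) (enum 'S_n) =i permutations (iota 1 n).
  have := @uniq_min_size _ (map (@one_line n) (enum 'S_n)) (permutations (iota 1 n)).
  case=> //.
  - by rewrite map_inj_uniq ?enum_uniq //; apply: one_line_inj.
  - by move=> _ /mapP[p _ ->]; rewrite mem_permutations perm_one_line.
  - by rewrite size_map -cardE card_Sn size_permutations ?iota_uniq // size_iota.
move: pw; rewrite -mem_permutations -e => /mapP[p _ wE].
by exists p; rewrite // mem_enum inE -wE; apply: avw.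
Qed.

(** * Generating function *)

Local Open Scope ring_scope.

(** Truncation after degree [n] turns the series into polynomials, where coefficient [n] of
    [D * F * D^-1] can be computed with two bracketings. *)
Lemma fps_div_unique (R : comUnitRingType) (D F N : fps R) :
  D 0%N \is a GRing.unit -> fps_mul D F =1 N -> F =1 fps_div N D.
Proof.
move=> uD DF n; pose t (a : fps R) : {poly R} := \poly_(i < n.+1) a i.
have tE a i : (i <= n)%N -> (t a)`_i = a i by move=> le_in; rewrite coef_poly ltnS le_in.
have mulE a b i : (i <= n)%N -> (t a * t b)`_i = fps_mul a b i.
  move=> le_in; rewrite coefM; apply: eq_bigr => j _.
  by rewrite !tE // (leq_trans _ le_in) ?leq_subr // -ltnS.
transitivity ((t D * t F * t (fps_inv D))`_n); last first.
  rewrite coefM; apply: eq_bigr => i _.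
  by rewrite mulE -1?ltnS // DF tE // leq_subr.
rewrite mulrAC mulrC coefM big_ord_recr /= big1 => [|i _].
  by rewrite add0r subnn mulE // fps_mulrV // /fps_of_poly coef1 mulr1 tE.
rewrite mulE ?leq_subr // fps_mulrV // /fps_of_poly coef1.
by rewrite subn_eq0 leqNgt ltn_ord mulr0.
Qed.

Lemma numerator_coef i :
  (1 - 6 *: 'X + 13 *: 'X^2 - 11 *: 'X^3 + 5 *: 'X^4 : {poly int})`_i =
  [:: 1; -6; 13; -11; 5]`_i.
Proof. by rewrite !coefE; case: i => [|[|[|[|[|i]]]]]; rewrite /= ?nth_nil. Qed.

Lemma denominator_coef i :
  ((1 - 'X) ^+ 2 * (1 - 2 *: 'X) * (1 - 3 *: 'X + 'X^2) : {poly int})`_i =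
  [:: 1; -7; 18; -21; 11; -2]`_i.
Proof.
have -> : (1 - 'X) ^+ 2 * (1 - 2 *: 'X) * (1 - 3 *: 'X + 'X^2) =
    1 - 7 *: 'X + 18 *: 'X^2 - 21 *: 'X^3 + 11 *: 'X^4 - 2 *: 'X^5 :> {poly int}.
  by rewrite -!mul_polyC !polyC_natr; ring.
by rewrite !coefE; case: i => [|[|[|[|[|[|i]]]]]]; rewrite /= ?nth_nil.
Qed.

Theorem theorem3 :
  avoiders_gf [:: [:: 2; 1; 4; 3]; [:: 2; 3; 4; 1]; [:: 3; 4; 1; 2]]%N
  =1 fps_div
       (fps_of_poly
          (1 - 6 *: 'X + 13 *: 'X^2 - 11 *: 'X^3 + 5 *: 'X^4 : {poly int}))
       (fps_of_poly
          ((1 - 'X) ^+ 2 * (1 - 2 *: 'X) * (1 - 3 *: 'X + 'X^2) : {poly int})).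
Proof.
apply: fps_div_unique => [|n]; first by rewrite /fps_of_poly denominator_coef.
rewrite /fps_mul /fps_of_poly numerator_coef.
pose f k := size (avl 1 k).
under eq_bigr => i _ do rewrite denominator_coef /avoiders_gf card_avoiders -/(f _).
have: [/\ f 0 = 1, f 1 = 1 &
      forall k, f k.+2 + f k + k.*2 + 3 = 3 * f k.+1 + 3 * 2 ^ k]%N.
  by split=> [||k]; [apply: size_avl0 | apply: size_avl1 | apply: avl_recurrence].
move: f => f [f0 f1 fS].
have f2 := fS 0%N; have f3 := fS 1%N; have f4 := fS 2%N.
rewrite -(big_mkord xpredT (fun i => [:: 1; -7; 18; -21; 11; -2]`_i * (f (n - i)%N)%:Z)).
(* The numerator has degree 4, so the coefficients up to 4 are checked from the initial values and
   all later ones must vanish. *)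
case: n => [|[|[|[|[|n]]]]].
1-5: by rewrite unlock /= ?subSS ?subn0; clear -f0 f1 f2 f3 f4; lia.
do 6!rewrite big_ltn //;
  rewrite big_nat_cond big1 => [|[|[|[|[|[|[|i]]]]]]] //; last first.
  by rewrite /= nth_nil mul0r.
rewrite /= !subSS !subn0 nth_nil.
(* The factor [1 - 3x + x^2] encodes the recurrence; the other factor, [1 - 4x + 5x^2 - 2x^3],
   weights its four instances and annihilates [2k + 3] and [2 ^ k]. *)
move: (fS n) (fS n.+1) (fS n.+2) (fS n.+3); clear; rewrite !expnS; lia.
Qed.
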